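(* Let $q$ be a power of $2$ and let $r,s$ be positive integers with $s\equiv r+2q\pmod{q+1}$. Let $B(x)\in\mathbb{F}_{q^2}[x]$ be such that $B(x)$ has no root in $\mu_{q+1}$ and $x\mapsto x^{r}B^{(q)}(1/x)/B(x)$ permutes $\mu_{q+1}$. Let $a\in\mathbb{F}_{q^2}\setminus\mathbb{F}_q$ and $b\in\mathbb{F}_q^{*}$. Then $$x^{s}B(x^{q-1})\left(a^{q}x^{2q(q-1)}+bx^{q(q-1)}+a\right)$$ permutes $\mathbb{F}_{q^2}$ if and only if $\gcd(s,q-1)=1$ and $\mathrm{Tr}\left(\frac{a^{q+1}}{b^{2}}\right)\neq 1$.
   Context: $\mu_{q+1}$ denotes the set of $(q+1)$-th roots of unity in $\mathbb{F}_{q^2}$. For $B(x)\in\mathbb{F}_{q^2}[x]$, $B^{(q)}(x)$ denotes the polynomial obtained from $B(x)$ by raising every coefficient to the $q$-th power. $\mathrm{Tr}$ is the absolute trace $\mathbb{F}_q\to\mathbb{F}_2$, $\mathrm{Tr}(x)=x+x^2+x^{2^2}+\cdots+x^{2^{m-1}}$ where $q=2^m$. A polynomial permutes a finite set if it induces a bijection of that set onto itself. *)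

(* Defs.v *)
From mathcomp Require Import all_boot all_order all_algebra.

Set Implicit Arguments.
Unset Strict Implicit.
Unset Printing Implicit Defensive.

Import GRing.Theory.
Local Open Scope ring_scope.

Definition mu (F : finFieldType) (n : nat) : {set F} :=
  [set x : F | n.-unity_root x].

Definition permutes (T : finType) (A : {set T}) (f : T -> T) : Prop :=
  {in A &, injective f} /\ f @: A = A.

Definition poly_permutes (F : finFieldType) (A : {set F}) (p : {poly F}) :
  Prop := permutes A (fun x => p.[x]).

(* [divring_closed] supplies 1, differences and quotients. Together with the
   cardinality it pins K down uniquely inside a finite F. *)
Definition subfield_of_card (F : finFieldType) (K : {set F}) (q : nat) : Prop :=
  divring_closed K /\ #|K| = q.

Definition pow_coefs (F : finFieldType) (q : nat) (p : {poly F}) : {poly F} :=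
  map_poly (fun c => c ^+ q) p.

(* Absolute trace of the field with 2 ^ m elements. It is applied only to
   elements of that subfield of F; its values lie in the prime field {0, 1},
   also viewed inside F. *)
Definition abs_trace (F : finFieldType) (m : nat) (x : F) : F :=
  \sum_(i < m) x ^+ (2 ^ i).

(* Main.v *)
Require Import Defs.
From mathcomp Require Import all_boot all_order all_algebra.
From mathcomp Require Import cyclic finfield ring.

Set Implicit Arguments.
Unset Strict Implicit.
Unset Printing Implicit Defensive.

Import GRing.Theory.
Local Open Scope ring_scope.

(** Write the polynomial as [x^s h(x^(q-1))], where on [mu_(q+1)] one has
    [h(y) = B(y) (a y^2 + b y + a^q) / y^2]. Such a map permutes [F] as soon as
    [gcd(s, q-1) = 1], [h] has no zero on [mu_(q+1)], and [y^s h(y)^(q-1)] is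
    injective on [mu_(q+1)]; the first two conditions are also necessary. Where
    [h] does not vanish, the quadratic factors cancel in [y^s h(y)^(q-1)] up to
    [y^2], which leaves the given permutation [y^r B^(q)(1/y) / B(y)].
    Finally, [y = (b/a) z] turns [a y^2 + b y + a^q = 0] into the
    Artin-Schreier equation [z^2 + z = c] with [c = a^(q+1)/b^2], and
    [y^(q+1) = 1] into [z^(q+1) = c], i.e. [z^q + z = 1]. As [z^q + z] is the
    trace of [z^2 + z], such a [z] exists exactly when [c] has trace 1. *)

(** * Roots of unity in a finite field *)

Lemma in_mu (F : finFieldType) n (x : F) : (x \in mu F n) = (x ^+ n == 1).
Proof. by rewrite inE unity_rootE. Qed.

Lemma mu_neq0 (F : finFieldType) n (x : F) :
  (0 < n)%N -> x \in mu F n -> x != 0.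
Proof.
move=> n_gt0; rewrite in_mu; apply: contraTneq => ->.
by rewrite expr0n eqn0Ngt n_gt0 eq_sym oner_eq0.
Qed.

Lemma finField_prim_root (F : finFieldType) :
  exists w : F, #|F|.-1.-primitive_root w.
Proof.
have n_gt0 : (0 < #|F|.-1)%N.
  by rewrite -ltnS prednK ?finNzRing_gt1 // ltnW ?finNzRing_gt1.
have /hasP[w _ w_prim] :
    has #|F|.-1.-primitive_root (enum [set~ (0 : F)]).
  apply: has_prim_root => //; rewrite ?enum_uniq //.
    apply/allP => x; rewrite mem_enum !inE => x_neq0.
    apply/unity_rootP/(mulfI x_neq0).
    by rewrite -exprS prednK ?expf_card ?mulr1 // ltnW ?finNzRing_gt1.
  by rewrite -cardE cardsC1.
by exists w.
Qed.

(** With [w] a primitive root and [y = w ^+ k], the equation [y ^+ e = 1] forces [d] to divide [k],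
    so [w ^+ (k / d)] is the required root. *)
Lemma expf_eq1_surj (F : finFieldType) (d e : nat) (y : F) :
  #|F|.-1 = (d * e)%N -> (0 < e)%N -> y ^+ e = 1 ->
  exists2 x, x != 0 & x ^+ d = y.
Proof.
move=> cardF e_gt0 ye1; have [w w_prim] := finField_prim_root F.
have y_neq0 : y != 0.
  apply: contra_eq_neq ye1 => ->.
  by rewrite expr0n eqn0Ngt e_gt0 eq_sym oner_eq0.
have [k yE] : exists k, y = w ^+ k.
  suff /(prim_rootP w_prim)[k ->] : y ^+ #|F|.-1 = 1 by exists k.
  by rewrite cardF mulnC exprM ye1 expr1n.
have /dvdnP[j kE] : (d %| k)%N.
  by rewrite -(dvdn_pmul2r e_gt0) -cardF (prim_order_dvd w_prim) exprM -yE ye1.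
have xd : (w ^+ j) ^+ d = y by rewrite -exprM -kE -yE.
exists (w ^+ j) => //; apply: contraNneq y_neq0 => x0.
rewrite -xd x0 expr0n; case: d {xd} cardF kE => // cardF.
by have := finNzRing_gt1 F; case: #|F| cardF => [|[]].
Qed.

(** The quotient [x / y] is killed by both exponents [s] and [d], hence by 1 through a Bezout
    relation [u * s = v * d + 1]. *)
Lemma coprime_expf_eq1 (F : fieldType) (s d : nat) (x y : F) : (0 < s)%N ->
  coprime s d -> y != 0 -> x ^+ s = y ^+ s -> x ^+ d = y ^+ d -> x = y.
Proof.
move=> s_gt0 co_sd y_neq0 eqs eqd; apply: (divIf y_neq0).
have z1 n : x ^+ n = y ^+ n -> (x / y) ^+ n = 1.
  by move=> E; rewrite expr_div_n E divff ?expf_neq0.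
case: (egcdnP d s_gt0) => u v uE _; rewrite (eqP co_sd) in uE.
rewrite divff // -[LHS]expr1; apply: (mulfI (_ : (x / y) ^+ (v * d) != 0)).
  by rewrite mulnC exprM z1 // expr1n oner_neq0.
by rewrite mulr1 -exprD -uE !(mulnC _ s) (mulnC v) !exprM !z1 ?expr1n.
Qed.

(** * Bijectivity of maps [x ^+ s * h (x ^+ d)] *)

Section CyclotomicMap.

Variables (F : finFieldType) (d e s : nat) (h : F -> F).
Hypotheses (cardF : #|F|.-1 = (d * e)%N) (s_gt0 : (0 < s)%N).

Let f x := x ^+ s * h (x ^+ d).

Let de_gt0 : (0 < d * e)%N.
Proof.
by rewrite -cardF -ltnS prednK ?finNzRing_gt1 // ltnW ?finNzRing_gt1.
Qed.

Let d_gt0 : (0 < d)%N. Proof. by move: de_gt0; rewrite muln_gt0 => /andP[]. Qed.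
Let e_gt0 : (0 < e)%N. Proof. by move: de_gt0; rewrite muln_gt0 => /andP[]. Qed.

(** A zero of [h] in [mu F e] is a [d]-th power of some [x != 0], and then [f x = 0 = f 0]. *)
Lemma cyclotomic_inj_neq0 :
  injective f -> forall y, y \in mu F e -> h y != 0.
Proof.
move=> f_inj y; rewrite in_mu => /eqP ye1; apply/eqP => hy0.
have [x /eqP x_neq0 xd] := expf_eq1_surj cardF e_gt0 ye1.
by apply/x_neq0/f_inj; rewrite /f xd hy0 mulr0 expr0n eqn0Ngt s_gt0 mul0r.
Qed.

(** A primitive root of unity [z] of order [gcdn s d] satisfies [f z = f 1]. *)
Lemma cyclotomic_inj_coprime : injective f -> coprime s d.
Proof.
move=> f_inj; have [w w_prim] := finField_prim_root F.
pose g := gcdn s d; have g_dvd : (g %| #|F|.-1)%N.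
  by rewrite cardF dvdn_mulr // dvdn_gcdr.
have z_prim := dvdn_prim_root w_prim g_dvd; set z := w ^+ _ in z_prim.
have z1 n : (g %| n)%N -> z ^+ n = 1.
  by rewrite (prim_order_dvd z_prim) => /eqP.
have : z = 1 by apply: f_inj; rewrite /f !z1 ?expr1n ?dvdn_gcdr ?dvdn_gcdl.
move/eqP; rewrite -[z]expr1 -(prim_order_dvd z_prim) dvdn1.
by rewrite /coprime.
Qed.

(** For [x != 0], the value [f x ^+ d] is the induced map at [x ^+ d], so [f x] determines [x ^+ d].
    Cancelling [h (x ^+ d)] then gives [x ^+ s], and coprimality gives [x]. *)
Lemma cyclotomic_inj :
    coprime s d -> (forall y, y \in mu F e -> h y != 0) ->
    {in mu F e &, injective (fun y => y ^+ s * h y ^+ d)} ->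
  injective f.
Proof.
move=> co_sd h_neq0 g_inj.
have mu_d x : x != 0 -> x ^+ d \in mu F e.
  move=> x_neq0; rewrite in_mu -exprM -cardF; apply/eqP/(mulfI x_neq0).
  by rewrite -exprS prednK ?expf_card ?mulr1 // ltnW ?finNzRing_gt1.
have f0 : f 0 = 0 by rewrite /f expr0n eqn0Ngt s_gt0 mul0r.
have f_neq0 x : x != 0 -> f x != 0.
  by move=> x_neq0; rewrite mulf_neq0 ?expf_neq0 ?h_neq0 ?mu_d.
have fd x : f x ^+ d = (x ^+ d) ^+ s * h (x ^+ d) ^+ d.
  by rewrite exprMn -!exprM mulnC.
move=> x y; have [->|x_neq0] := eqVneq x 0.
  by have [->//|/f_neq0] := eqVneq y 0; rewrite f0 => /eqP ne /esym.
have [->|y_neq0] := eqVneq y 0.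
  by move/eqP: (f_neq0 _ x_neq0); rewrite f0.
move=> eq_f; have eq_d : x ^+ d = y ^+ d.
  by apply: g_inj; rewrite ?mu_d // -!fd eq_f.
apply: (coprime_expf_eq1 s_gt0 co_sd) => //.
by move: eq_f; rewrite /f eq_d => /mulIf; apply; rewrite h_neq0 ?mu_d.
Qed.

End CyclotomicMap.

(** * Frobenius powers, the trace and Artin-Schreier equations in characteristic 2 *)

Section Char2.

Variables (F : finFieldType) (char2 : 2%N \in [pchar F]).

Lemma exprD_pchar2 k (x y : F) :
  (x + y) ^+ (2 ^ k) = x ^+ (2 ^ k) + y ^+ (2 ^ k).
Proof. by rewrite exprDn_pchar // pnatX pnatE ?char2. Qed.

Lemma horner_pow_coefs k (p : {poly F}) (x : F) :
  (pow_coefs (2 ^ k) p).[x ^+ (2 ^ k)] = p.[x] ^+ (2 ^ k).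
Proof.
rewrite (@horner_coef_wide _ (size p)) ?size_poly // horner_coef.
rewrite (big_endo (fun y : F => y ^+ (2 ^ k))).
- apply: eq_bigr => i _; rewrite coef_map_id0; last first.
    by rewrite expr0n expn_eq0.
  by rewrite exprMn -!exprM mulnC.
- exact: exprD_pchar2.
- by rewrite expr0n expn_eq0.
Qed.

Lemma abs_trace_artin_schreier n (z : F) :
  abs_trace n (z ^+ 2 + z) = z ^+ (2 ^ n) + z.
Proof.
rewrite /abs_trace; elim: n => [|n IHn].
  by rewrite big_ord0 expr1 addrr_pchar2.
rewrite big_ord_recr /= IHn exprD_pchar2 -exprM -expnS.
by rewrite addrC -addrA [X in _ + X]addrA addrr_pchar2 // add0r.
Qed.

Lemma abs_trace_root n (c : F) :
  root (\sum_(i < n) 'X^(2 ^ i)) c = (abs_trace n c == 0).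
Proof.
by rewrite /root horner_sum; under eq_bigr do rewrite hornerXn.
Qed.

Lemma size_abs_trace_poly n :
  size (\sum_(i < n.+1) 'X^(2 ^ i) : {poly F}) = (2 ^ n).+1.
Proof.
elim: n => [|n IHn]; first by rewrite big_ord1 size_polyXn.
rewrite big_ord_recr /= addrC size_polyDl ?size_polyXn // IHn ltnS.
by rewrite ltn_exp2l.
Qed.

(** Each fibre of [x ^+ 2 + x] lies in a pair [x0], [x0 + 1]. *)
Lemma card_artin_schreier_image :
  (#|F| <= 2 * #|[set (x ^+ 2 + x)%R | x : F]|)%N.
Proof.
rewrite -[leqLHS]sum1_card (partition_big_imset (fun x : F => x ^+ 2 + x)) /=.
rewrite mulnC -sum_nat_const; apply: leq_sum => y /imsetP[x0 _ ->].
rewrite sum1dep_card; apply: (@leq_trans #|[set x0; x0 + 1]|).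
  apply: subset_leq_card; apply/subsetP => x; rewrite !inE /=.
  move/eqP => E; rewrite -(subr_eq0 x) -(subr_eq0 x (x0 + 1)) -mulf_eq0.
  rewrite !(oppr_pchar2 char2).
  have -> : (x + x0) * (x + (x0 + 1)) = (x ^+ 2 + x) + (x0 ^+ 2 + x0) +
      (x * x0 + x * x0).
    by ring.
  by rewrite E !addrr_pchar2 // addr0.
by rewrite cards2; case: (_ != _).
Qed.

(* The trace polynomial has degree [#|F| / 2] and vanishes on the image of
   [z^2 + z], which has at least that many elements. *)
Lemma artin_schreier_solvable n (c : F) :
  #|F| = (2 ^ n.+1)%N -> abs_trace n.+1 c = 0 -> exists z, z ^+ 2 + z = c.
Proof.
move=> cardF tr0; pose I := [set x ^+ 2 + x | x : F].
have [/imsetP[z _ ->]|cI] := boolP (c \in I); first by exists z.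
have P_neq0 : \sum_(i < n.+1) 'X^(2 ^ i) != 0 :> {poly F}.
  by rewrite -size_poly_eq0 size_abs_trace_poly.
have := @max_poly_roots _ _ (c :: enum I) P_neq0.
rewrite /= mem_enum cI enum_uniq abs_trace_root tr0 eqxx /= -cardE.
rewrite size_abs_trace_poly ltnS => /(_ _ isT); rewrite ltnNge.
have := card_artin_schreier_image; rewrite cardF expnS leq_pmul2l // => -> H.
suff: false by []; apply: H; apply/allP => y; rewrite mem_enum.
case/imsetP=> x _ ->; rewrite abs_trace_root abs_trace_artin_schreier.
by rewrite -cardF expf_card addrr_pchar2.
Qed.

End Char2.

(** Multiplication by [x != 0] permutes [K :\ 0]; comparing the products of all elements gives
    [x ^+ (q - 1) = 1]. *)
Lemma subfield_of_card_expr (F : finFieldType) (K : {set F}) q x :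
  subfield_of_card K q -> x \in K -> x ^+ q = x.
Proof.
case=> -[K1 KB Kdiv] <- Kx.
have K0 : 0 \in K by rewrite -(subrr 1) KB.
have q_gt0 : (0 < #|K|)%N by apply/card_gt0P; exists 0.
have [->|x_neq0] := eqVneq x 0; first by rewrite expr0n eqn0Ngt q_gt0.
have KM y : (x * y \in K) = (y \in K).
  apply/idP/idP => Ky; first by rewrite -[y](mulKf x_neq0) mulrC Kdiv.
  by rewrite -[y]invrK Kdiv // -div1r Kdiv.
pose P := \prod_(y in K :\ 0) y.
have P_neq0 : P != 0.
  by apply/prodf_neq0 => y; rewrite !inE => /andP[].
suff : P = x ^+ #|K :\ 0| * P.
  rewrite -{1}[P]mul1r => /(mulIf P_neq0) x1.
  by rewrite (cardsD1 0) K0 add1n exprS -x1 mulr1.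
rewrite {1}/P (reindex_inj (mulfI x_neq0)) /=.
rewrite (eq_bigl (mem (K :\ 0))) => [|y]; last first.
  by rewrite !inE mulf_eq0 (negPf x_neq0) KM.
by rewrite big_split /= prodr_const.
Qed.

(** * Roots of the quadratic factor on [mu F (q + 1)] *)

Lemma quadratic_root_mu (F : finFieldType) (m : nat) (a b : F) :
    (0 < m)%N -> #|F| = ((2 ^ m) ^ 2)%N -> a != 0 -> b != 0 ->
    b ^+ (2 ^ m) = b ->
  (exists2 y, y \in mu F (2 ^ m + 1) & a * y ^+ 2 + b * y + a ^+ (2 ^ m) = 0)
  <-> abs_trace m (a ^+ (2 ^ m + 1) / b ^+ 2) = 1.
Proof.
move=> m_gt0 cardF a_neq0 b_neq0; set q := (2 ^ m)%N => bq.
have cardF' : #|F| = (2 ^ (m + m))%N by rewrite cardF -expnM muln2 addnn.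
have char2 : 2%N \in [pchar F] by apply: card_finPcharP cardF' _.
set c := a ^+ (q + 1) / b ^+ 2.
have c_neq0 : c != 0 by rewrite mulf_neq0 ?invr_eq0 ?expf_neq0.
have aqq : (a ^+ q) ^+ q = a by rewrite -exprM mulnn -cardF expf_card.
have cq : c ^+ q = c.
  by rewrite /c addn1 exprSr expr_div_n exprMn aqq (exprAC b) bq (mulrC a).
have root_equiv z :
  (a * (b / a * z) ^+ 2 + b * (b / a * z) + a ^+ q == 0) = (z ^+ 2 + z == c).
  have -> : a * (b / a * z) ^+ 2 + b * (b / a * z) + a ^+ q =
            b ^+ 2 / a * (z ^+ 2 + z + c).
    by rewrite /c addn1 (exprSr a); field; rewrite a_neq0 b_neq0.
  rewrite mulf_eq0 mulf_eq0 invr_eq0 expf_eq0 /= (negPf a_neq0) (negPf b_neq0).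
  by rewrite /= -(subr_eq0 _ c) (oppr_pchar2 char2).
have mu_equiv z : (b / a * z \in mu F (q + 1)) = (z ^+ (q + 1) == c).
  rewrite in_mu; have -> : (b / a * z) ^+ (q + 1) = c^-1 * z ^+ (q + 1).
    by rewrite exprMn expr_div_n /c invf_div addn1 (exprSr b q) bq -expr2.
  by rewrite -(inj_eq (mulfI c_neq0)) mulVKf // mulr1.
split.
- case=> y y_mu y_root.
  have [z yE] : exists z, y = b / a * z.
    by exists (a / b * y); rewrite -(invf_div a b) mulKf // mulf_neq0 ?invr_eq0.
  move: y_mu y_root; rewrite yE mu_equiv => /eqP zq1 /eqP.
  rewrite root_equiv => /eqP zc.
  have z_neq0 : z != 0.
    by apply: contraNneq c_neq0 => z0; rewrite -zq1 z0 addn1 exprSr mulr0.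
  rewrite -zc abs_trace_artin_schreier //.
  (* Divide [z ^+ (q + 1) = c = z ^+ 2 + z] by [z]. *)
  suff -> : z ^+ q = z + 1 by rewrite addrAC addrr_pchar2 ?add0r.
  apply: (mulIf z_neq0); rewrite -exprSr -addn1 zq1 -zc; ring.
- move=> tr1.
  (* Since [c ^+ q = c], the trace of [c] from all of [F] is twice its trace from the subfield, so
     the Artin-Schreier equation is solvable in [F]. *)
  have tr0 : abs_trace (m + m) c = 0.
    rewrite /abs_trace big_split_ord /=.
    rewrite [X in _ + X](eq_bigr (fun i : 'I_m => c ^+ (2 ^ i))) => [|i _].
      by rewrite addrr_pchar2.
    by rewrite expnD exprM -/q cq.
  have [z zc] : exists z, z ^+ 2 + z = c.
    apply: (artin_schreier_solvable char2 (n := (m + m).-1)).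
      by rewrite prednK // addn_gt0 m_gt0.
    by rewrite prednK // addn_gt0 m_gt0.
  have zq : z ^+ q = z + 1.
    move: tr1; rewrite -zc abs_trace_artin_schreier // -/q => <-.
    by rewrite addrCA addrr_pchar2 // addr0.
  exists (b / a * z); last by apply/eqP; rewrite root_equiv zc.
  by rewrite mu_equiv addn1 exprSr zq -zc; apply/eqP; ring.
Qed.

Theorem theorem3p9 (m q : nat) (hm : (0 < m)%N) (hq : q = (2 ^ m)%N)
  (F : finFieldType) (hF : #|F| = (q ^ 2)%N)
  (Fq : {set F}) (hFq : subfield_of_card Fq q)
  (r s : nat) (hr : (0 < r)%N) (hs : (0 < s)%N)
  (hrs : s = r + 2 * q %[mod q + 1])
  (B : {poly F})
  (hB : forall x, x \in mu F (q + 1) -> ~~ root B x)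
  (hperm : permutes (mu F (q + 1))
     (fun x => x ^+ r * (pow_coefs q B).[1 / x] / B.[x]))
  (a b : F) (ha : a \notin Fq) (hb : b \in Fq) (hb0 : b != 0) :
  poly_permutes [set: F]
    ('X^s * (B \Po 'X^(q - 1)) *
     ((a ^+ q)%:P * 'X^(2 * q * (q - 1)) + b%:P * 'X^(q * (q - 1)) + a%:P))
  <-> (gcdn s (q - 1) = 1%N /\ abs_trace m (a ^+ (q + 1) / b ^+ 2) <> 1).
Proof.
have q_gt0 : (0 < q)%N by rewrite hq expn_gt0.
have cardF : #|F|.-1 = ((q - 1) * (q + 1))%N.
  by rewrite hF -subn1 -[1%N in LHS](exp1n 2) subn_sqr.
have char2 : 2%N \in [pchar F].
  by apply: (@card_finPcharP _ _ (m * 2)); rewrite // hF hq expnM.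
have a_neq0 : a != 0.
  apply: contraNneq ha => ->; case: hFq => -[K1 KB _] _.
  by rewrite -(subrr 1) KB.
have bq : b ^+ q = b := subfield_of_card_expr hFq hb.
have aqq : (a ^+ q) ^+ q = a by rewrite -exprM mulnn -hF expf_card.
pose Q y := a * y ^+ 2 + b * y + a ^+ q.
pose h y := B.[y] * (a ^+ q * y ^+ (2 * q) + b * y ^+ q + a).
set p := (X in poly_permutes _ X).
have pE x : p.[x] = x ^+ s * h (x ^+ (q - 1)).
  rewrite /p /h !(hornerM, hornerD, hornerC, horner_comp, hornerXn) -!exprM.
  by rewrite -mulrA !(mulnC (q - 1)%N).
have p_perm : poly_permutes [set: F] p <->
    injective (fun x => x ^+ s * h (x ^+ (q - 1))).
  split=> [[p_inj _] x y E|p_inj]; first by apply: p_inj; rewrite ?inE // !pE.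
  have p_inj' : injective (fun x => p.[x]) by move=> x y; rewrite !pE => /p_inj.
  split=> [x y _ _ /p_inj' //|]; apply/eqP.
  by rewrite eqEcard subsetT card_imset ?leqnn.
have muq y : y \in mu F (q + 1) -> y ^+ q = y^-1.
  rewrite in_mu addn1 exprSr => /eqP E.
  have y_neq0 : y != 0.
    by apply: contra_eq_neq E => ->; rewrite mulr0 eq_sym oner_neq0.
  by apply: (mulIf y_neq0); rewrite E mulVf.
have mu0 y : y \in mu F (q + 1) -> y != 0 by apply: mu_neq0; rewrite addn1.
have hE y : y \in mu F (q + 1) -> h y = B.[y] * (Q y / y ^+ 2).
  move=> y_mu; rewrite /h /Q mulnC exprM (muq y) //; have := mu0 y y_mu.
  by move=> y_neq0; field.
have h_eq0 y : y \in mu F (q + 1) -> (h y == 0) = (Q y == 0).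
  move=> y_mu; rewrite hE // !mulf_eq0 invr_eq0 expf_eq0 /= (negPf (mu0 _ y_mu)).
  by rewrite orbF -rootE (negPf (hB _ y_mu)).
(* The [q]-th power exchanges [a] and [a ^+ q], fixes [b] and inverts [y]: the quadratic is
   self-reciprocal. *)
have Qq y : y \in mu F (q + 1) -> Q y ^+ q = Q y / y ^+ 2.
  move=> y_mu; rewrite /Q hq !exprD_pchar2 // -hq (exprMn _ a) (exprMn _ b).
  rewrite aqq bq (exprAC y) (muq y) //.
  by have y_neq0 := mu0 y y_mu; field.
have gE y : y \in mu F (q + 1) -> Q y != 0 ->
    y ^+ s * h y ^+ (q - 1) = y ^+ r * (pow_coefs q B).[1 / y] / B.[y].
  move=> y_mu Qy_neq0; have y_neq0 := mu0 y y_mu.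
  have By_neq0 : B.[y] != 0 := hB y y_mu.
  have hy_neq0 : h y != 0 by rewrite h_eq0.
  (* Here [s + 2] is congruent to [r + 2 * (q + 1)], hence to [r], modulo [q + 1]. *)
  have y_s2 : y ^+ s * y ^+ 2 = y ^+ r.
    have y1 : y ^+ (q + 1) = 1 by apply/eqP; rewrite -in_mu.
    rewrite -(expr_mod s y1) hrs expr_mod // -exprD -addnA.
    rewrite -[X in (_ + (_ + X))%N]muln1 -mulnDr exprD.
    by rewrite (mulnC 2) exprM y1 expr1n mulr1.
  have Bq : (pow_coefs q B).[1 / y] = B.[y] ^+ q.
    by rewrite div1r -muq // hq horner_pow_coefs.
  (* Multiplying by [h y] raises the exponent [q - 1] to [q], where [(Q y / y ^+ 2) ^+ q = Q y]. *)
  rewrite Bq; apply: (mulIf hy_neq0); rewrite -[LHS]mulrA -exprSr subn1 prednK //.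
  rewrite hE // exprMn expr_div_n Qq // (exprAC y) (muq y) // -y_s2.
  by field; rewrite y_neq0 By_neq0 oner_neq0.
have no_root : (forall y, y \in mu F (q + 1) -> Q y != 0) <->
    abs_trace m (a ^+ (q + 1) / b ^+ 2) <> 1.
  have := @quadratic_root_mu F m a b hm; rewrite -hq => /(_ hF a_neq0 hb0 bq) E.
  split=> [Q_neq0 /E[y /Q_neq0/eqP]//|tr_neq1 y y_mu].
  by apply/eqP => Qy0; apply/tr_neq1/E; exists y.
rewrite p_perm -no_root; split=> [p_inj|[co_s Q_neq0]].
  split; first exact/eqP/(cyclotomic_inj_coprime cardF p_inj).
  by move=> y y_mu; rewrite -h_eq0 // (cyclotomic_inj_neq0 cardF hs p_inj).
apply: (cyclotomic_inj cardF hs); first exact/eqP.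
  by move=> y y_mu; rewrite h_eq0 ?Q_neq0.
(* On [mu F (q + 1)] the induced map is now the given permutation. *)
move=> x y x_mu y_mu; rewrite !gE ?Q_neq0 //.
exact: (proj1 hperm).
Qed.
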